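(* For $m,n_1,\dots,n_m\in\mathbf{N}$ and $\mathcal{X}\in\mathbf{T}(n_1,\dots,n_m)$, let $X_{(j)}$ be the mode-$j$ unfolding of $\mathcal{X}$ and let $r_j$ be the matrix rank of $X_{(j)}$ for $j=1,\dots,m$. Then the function $r$ defined by $r(\mathcal{X})=\mathrm{submax}\{r_1,\dots,r_m\}$ is a strongly proper tensor rank function, but it is not subadditive.
   Context: $\mathbf{Z}_+$ is the set of nonnegative integers and $\mathbf{N}$ the set of positive integers. For $m,n_1,\dots,n_m\in\mathbf{N}$, $\mathbf{T}(n_1,\dots,n_m)$ is the set of real $m$th order tensors $\mathcal{X}=(x_{i_1\cdots i_m})$ of dimension $n_1\times\cdots\times n_m$; $\mathbf{CT}(m,n)$ is the case $n_1=\cdots=n_m=n$; $\mathbf{T}$ is the set of all real tensors. A tensor $\mathcal{X}\in\mathbf{T}(n_1,\dots,n_m)$ is rank-one if $\mathcal{X}=\mathbf{x}^{(1)}\circ\cdots\circ\mathbf{x}^{(m)}$ (outer product) with nonzero $\mathbf{x}^{(i)}\in\mathbb{R}^{n_i}$. The identity tensor $\mathcal{I}_{m,n}\in\mathbf{CT}(m,n)$ has entries $1$ when $i_1=\cdots=i_m$ and $0$ otherwise. A subtensor of $\mathcal{X}\in\mathbf{T}(n_1,\dots,n_m)$ is a tensor of the same order $m$ obtained by choosing nonempty index sets $T_l\subseteq\{1,\dots,n_l\}$, $l=1,\dots,m$, and restricting $\mathcal{X}$ to $T_1\times\cdots\times T_m$; it is an element of $\mathbf{T}(|T_1|,\dots,|T_m|)$.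 A function $r:\mathbf{T}\to\mathbf{Z}_+$ is a tensor rank function if: (1) $r(\mathcal{X})=0$ iff $\mathcal{X}$ is a zero tensor, and $r(\mathcal{X})=1$ iff $\mathcal{X}$ is a rank-one tensor; (2) $r(\mathcal{I}_{m,n})=n$ for all $m,n\in\mathbf{N}$ with $m\ge2$; (3) for $n_1,n_2\in\mathbf{N}$ and $\mathcal{X}\in\mathbf{T}(n_1,n_2,1,\dots,1)$, $r(\mathcal{X})$ equals the matrix rank of the $n_1\times n_2$ matrix corresponding to $\mathcal{X}$; (4) $r(\alpha\mathcal{X})=r(\mathcal{X})$ for every tensor $\mathcal{X}$ and real $\alpha\ne0$; (5) $r(\mathcal{Y})=r(\mathcal{X})$ whenever $\mathcal{Y}$ is obtained from $\mathcal{X}$ by permuting its modes, i.e. $\sigma$ is a permutation of the $m$ coordinates, $\mathcal{Y}$ has dimensions $\sigma(n_1,\dots,n_m)$, and the entry of $\mathcal{Y}$ at position $\sigma(i_1,\dots,i_m)$ is $x_{i_1\cdots i_m}$; (6) $r(\mathcal{Y})\le r(\mathcal{X})$ whenever $\mathcal{Y}$ is a subtensor of $\mathcal{X}$. For $m\ge2$, $\mathrm{submax}$ of a list of $m$ numbers is its second largest value, counted with multiplicity (e.g. $\mathrm{submax}\{n,n,n\}=n$). A tensor rank function $r$ is strongly proper if $r(\mathcal{X})\le\mathrm{submax}\{n_1,\dots,n_m\}$ for all $m,n_1,\dots,n_m\in\mathbf{N}$ with $m\ge2$ and all $\mathcal{X}\in\mathbf{T}(n_1,\dots,n_m)$. It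 is subadditive if $r(\mathcal{X}+\mathcal{Y})\le r(\mathcal{X})+r(\mathcal{Y})$ for all $m,n_1,\dots,n_m\in\mathbf{N}$ and $\mathcal{X},\mathcal{Y}\in\mathbf{T}(n_1,\dots,n_m)$. Mode-$j$ unfolding: $X_{(j)}\in\mathbb{R}^{n_j\times(n_1\cdots n_{j-1}n_{j+1}\cdots n_m)}$ is the matrix whose rows are indexed by $i_j$, whose columns are indexed by $(i_1,\dots,i_{j-1},i_{j+1},\dots,i_m)$, and whose entries are $x_{i_1\cdots i_m}$. *)

(* Defs.v *)
From HB Require Import structures.
From mathcomp Require Import all_boot all_order all_algebra all_fingroup.
From mathcomp Require Import reals.
Set Implicit Arguments.
Unset Strict Implicit.
Unset Printing Implicit Defensive.
Import GRing.Theory.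
Local Open Scope ring_scope.

(* The order [m] and the dimensions [n j] are arbitrary naturals at the level
   of types; the axioms below only speak about [valid_dims n], i.e. about the
   tensors with [m, n_1, ..., n_m] all positive. *)
Definition valid_dims (m : nat) (n : 'I_m -> nat) : Prop :=
  (0 < m)%N /\ forall j, (0 < n j)%N.

Definition multi_index (m : nat) (n : 'I_m -> nat) :=
  {dffun forall j : 'I_m, 'I_(n j)}.

Definition tensor (R : Type) (m : nat) (n : 'I_m -> nat) :=
  {ffun multi_index n -> R}.

Section Tensors.
Variable R : realType.

Definition rank_one (m : nat) (n : 'I_m -> nat) (X : tensor R n) : Prop :=
  exists x : forall j : 'I_m, 'rV[R]_(n j),
    (forall j, x j != 0) /\ forall i, X i = \prod_(j < m) x j 0 (i j).

Definition identity_tensor (m n : nat) : tensor R (fun _ : 'I_m => n) :=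
  [ffun i : multi_index (fun _ : 'I_m => n) =>
    ([forall j, [forall k, i j == i k]])%:R].

Definition scale_tensor (m : nat) (n : 'I_m -> nat) (a : R) (X : tensor R n) :
    tensor R n :=
  [ffun i => a * X i].

(* [enum_val] lists the elements of [T j] in increasing order. *)
Definition subtensor (m : nat) (n : 'I_m -> nat) (X : tensor R n)
    (T : forall j : 'I_m, {set 'I_(n j)}) : tensor R (fun j => #|T j|) :=
  [ffun i : multi_index (fun j => #|T j|) =>
    X (finfun (fun j : 'I_m => enum_val (i j)))].

(* A permutation [s] sends a list [(a_1, ..., a_m)] to
   [(a_(s 1), ..., a_(s m))]; since this is a bijection on multi-indices, the
   condition determines [Y]. *)
Definition mode_permuted (m : nat) (n : 'I_m -> nat) (s : 'S_m)
    (X : tensor R n) (Y : tensor R (fun j => n (s j))) : Prop :=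
  forall i : multi_index n, Y (finfun (fun j : 'I_m => i (s j))) = X i.

(* The dimensions (n1, n2, 1, ..., 1) of order k + 2. *)
Definition matrix_dims (k n1 n2 : nat) : 'I_k.+2 -> nat :=
  fun j => nth 1%N [:: n1; n2] j.

Definition corresponding_matrix (k n1 n2 : nat)
    (X : tensor R (@matrix_dims k n1 n2)) (A : 'M[R]_(n1, n2)) : Prop :=
  forall i : multi_index (@matrix_dims k n1 n2),
    X i = A (i ord0) (i (lift ord0 ord0)).

Definition tensor_function := forall (m : nat) (n : 'I_m -> nat),
  tensor R n -> nat.

(* The second largest entry counted with multiplicity. The default value of
   [nth] is only reached for lists of length at most 1; it makes the submax of
   a one-element list its only entry. *)
Definition submax (s : seq nat) : nat := nth (head 0%N s) (sort geq s) 1%N.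

Record tensor_rank_function (r : tensor_function) : Prop := {
  trf_zero : forall (m : nat) (n : 'I_m -> nat) (X : tensor R n),
    valid_dims n -> r m n X = 0%N <-> X = 0;
  trf_one : forall (m : nat) (n : 'I_m -> nat) (X : tensor R n),
    valid_dims n -> r m n X = 1%N <-> rank_one X;
  trf_identity : forall m n : nat, (2 <= m)%N -> (0 < n)%N ->
    r m (fun=> n) (identity_tensor m n) = n;
  trf_matrix : forall (k n1 n2 : nat) (X : tensor R (@matrix_dims k n1 n2))
      (A : 'M[R]_(n1, n2)),
    (0 < n1)%N -> (0 < n2)%N -> corresponding_matrix X A ->
    r k.+2 (@matrix_dims k n1 n2) X = \rank A;
  trf_scale : forall (m : nat) (n : 'I_m -> nat) (X : tensor R n) (a : R),
    valid_dims n -> a != 0 -> r m n (scale_tensor a X) = r m n X;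
  trf_perm : forall (m : nat) (n : 'I_m -> nat) (s : 'S_m) (X : tensor R n)
      (Y : tensor R (fun j => n (s j))),
    valid_dims n -> mode_permuted X Y -> r m (fun j => n (s j)) Y = r m n X;
  trf_sub : forall (m : nat) (n : 'I_m -> nat) (X : tensor R n)
      (T : forall j : 'I_m, {set 'I_(n j)}),
    valid_dims n -> (forall j, T j != set0) ->
    (r m (fun j => #|T j|) (subtensor X T) <= r m n X)%N
}.

Definition strongly_proper (r : tensor_function) : Prop :=
  forall (m : nat) (n : 'I_m -> nat) (X : tensor R n),
    (2 <= m)%N -> valid_dims n ->
    (r m n X <= submax [seq n j | j <- enum 'I_m])%N.

Definition subadditive (r : tensor_function) : Prop :=
  forall (m : nat) (n : 'I_m -> nat) (X Y : tensor R n),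
    valid_dims n -> (r m n (X + Y)%R <= r m n X + r m n Y)%N.

(* Multi-indices with the [j]-th component removed. *)
Definition other_index (m : nat) (n : 'I_m -> nat) (j : 'I_m) :=
  multi_index (fun l : 'I_m.-1 => n (lift j l)).

(* The multi-index [i] with [i j = a] and [i (lift j l) = c l]. *)
Definition insert_index (m : nat) (n : 'I_m -> nat) (j : 'I_m)
    (a : 'I_(n j)) (c : other_index n j) : multi_index n :=
  finfun (fun k : 'I_m =>
    match unliftP j k with
    | UnliftSome l k_eq => cast_ord (congr1 n (esym k_eq)) (c l)
    | UnliftNone k_eq => cast_ord (congr1 n (esym k_eq)) a
    end).

Definition unfolding (m : nat) (n : 'I_m -> nat) (j : 'I_m) (X : tensor R n) :
    'M[R]_(n j, #|{: other_index n j}|) :=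
  \matrix_(a, b) X (insert_index a (enum_val b)).

Definition submax_rank : tensor_function := fun m n X =>
  submax [seq \rank (unfolding j X) | j <- enum 'I_m].

End Tensors.

(* Main.v *)
(** Let r_j be the rank of the mode-j unfolding. Since submax exceeds k iff two
    of the r_j do (one, when m = 1), every axiom except the rank-one one reduces
    to a statement about each r_j separately. If r_j <= 1, the vanishing of the
    2x2 minors of the unfolding gives
    X(i) X(p) = X(i with i_j := p_j) X(p with p_j := i_j). When submax is 1 this
    holds for all modes j but one, say j0, and resetting these modes in turn to
    a base point p with X(p) != 0 writes X(i) as X(p with p_j0 := i_j0) times
    the product of X(p with p_j := i_j) / X(p) over j != j0, so X is rank-one.
    Subadditivity fails because X and Y can have their single large mode rank in
    different modes, so that X + Y has two large mode ranks. *)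
Require Import Defs.
From mathcomp Require Import all_boot all_order all_algebra all_fingroup.
From mathcomp Require Import reals.
Set Implicit Arguments.
Unset Strict Implicit.
Unset Printing Implicit Defensive.
Import GRing.Theory.
Local Open Scope ring_scope.

(** * Threshold counting for the second largest value *)

(** Sorting preserves the count, so only the second sorted entry matters. The [minn] covers a
    one-element list, whose [submax] is its entry. *)
Lemma submax_gt (s : seq nat) (k : nat) : (0 < size s)%N ->
  (k < submax s)%N = (minn 2 (size s) <= count (fun x => k < x) s)%N.
Proof.
case: s => [|a [|b s]] // _; first by rewrite /submax /= addn0; case: (k < a)%N.
rewrite /submax -(count_sort geq) (minn_idPl _) //.
have := size_sort geq [:: a, b & s].
have: sorted geq (sort geq [:: a, b & s]).
  by apply: sort_sorted => x y; exact: leq_total.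
case: (sort geq _) => [|x [|y t]] //= /andP[y_le_x y_ge_t] _.
have geq_trans : transitive geq by move=> u v w /= vu uw; exact: leq_trans uw vu.
case: ltnP => [k_lt_y|y_le_k]; first by rewrite (leq_trans k_lt_y y_le_x).
(* All entries after [y] are at most [y], hence at most [k]; only the head can still exceed [k]. *)
rewrite (@eq_in_count _ _ pred0) ?count_pred0 ?addn0; first by case: (k < x)%N.
move=> z /(allP (order_path_min geq_trans y_ge_t)) z_le_y.
by apply/negbTE; rewrite -leqNgt (leq_trans z_le_y).
Qed.

Section SubmaxFamily.
Variable m : nat.
Hypothesis m_gt0 : (0 < m)%N.
Implicit Types f g : 'I_m -> nat.

Lemma submax_family_gt f k :
  (k < submax [seq f j | j <- enum 'I_m])%N =
  (minn 2 m <= #|[pred j | (k < f j)%N]|)%N.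
Proof.
rewrite submax_gt size_map size_enum_ord // count_map.
by rewrite -size_filter enumT cardE.
Qed.

Lemma leq_submax f g : (forall j, f j <= g j)%N ->
  (submax [seq f j | j <- enum 'I_m] <= submax [seq g j | j <- enum 'I_m])%N.
Proof.
move=> le_fg; case: leqP => //; set k := submax _.
rewrite submax_family_gt => /leq_trans card_f.
have: (k < submax [seq g j | j <- enum 'I_m])%N; last by rewrite ltnn.
rewrite submax_family_gt; apply/card_f/subset_leq_card/subsetP => j.
by rewrite !inE => /leq_trans; apply.
Qed.

Lemma submax_family_const (c : nat) : submax [seq c | j <- enum 'I_m] = c.
Proof.
have gt k : (k < submax [seq c | j <- enum 'I_m])%N = (k < c)%N.
  rewrite submax_family_gt; case: (k < c)%N.
    by rewrite eq_cardT ?size_enum_ord ?geq_minr.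
  by rewrite eq_card0 // leqNgt leq_min m_gt0.
apply/eqP; rewrite eqn_leq; apply/andP; split; rewrite leqNgt.
  by rewrite gt ltnn.
by rewrite -gt ltnn.
Qed.

Lemma submax_perm f (s : 'S_m) :
  submax [seq f (s j) | j <- enum 'I_m] = submax [seq f j | j <- enum 'I_m].
Proof.
have gt k : (k < submax [seq f (s j) | j <- enum 'I_m])%N =
            (k < submax [seq f j | j <- enum 'I_m])%N.
  rewrite !submax_family_gt; congr (_ <= _)%N.
  by rewrite -!sum1_card [RHS](reindex_inj (@perm_inj _ s)).
apply/eqP; rewrite eqn_leq; apply/andP; split; rewrite leqNgt.
  by rewrite gt ltnn.
by rewrite -gt ltnn.
Qed.

Lemma submax_le_family f k :
  (forall j, f j <= k)%N -> (submax [seq f j | j <- enum 'I_m] <= k)%N.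
Proof. by move=> le_fk; rewrite -[k in (_ <= k)%N]submax_family_const leq_submax. Qed.

Lemma submax_ge_pair f k (j1 j2 : 'I_m) : j1 != j2 ->
  (k <= f j1)%N -> (k <= f j2)%N ->
  (k <= submax [seq f j | j <- enum 'I_m])%N.
Proof.
case: k => // k j12 k1 k2; rewrite submax_family_gt.
(* [cards2] states the cardinality of a pair as [(j1 != j2).+1], so 2 is put into that shape. *)
apply: (leq_trans (geq_minl _ _)); rewrite -[2%N]/((true).+1) -j12 -cards2.
by apply/subset_leq_card/subsetP => j; rewrite !inE => /orP[]/eqP->.
Qed.

(** With at least two modes, a single value above [k] does not lift the submax above [k]; for
    [m = 1] it would. *)
Lemma submax_le_all_but f k (j0 : 'I_m) : (1 < m)%N ->
  (forall j, j != j0 -> f j <= k)%N ->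
  (submax [seq f j | j <- enum 'I_m] <= k)%N.
Proof.
move=> m_gt1 le_fk; rewrite leqNgt submax_family_gt -ltnNge (minn_idPl m_gt1).
rewrite ltnS -(card1 j0); apply/subset_leq_card/subsetP => j; rewrite !inE.
by apply: contraTT => /le_fk; rewrite leqNgt.
Qed.

Lemma submax_le_exists f k : (submax [seq f j | j <- enum 'I_m] <= k)%N ->
  exists j0 : 'I_m, forall j, j != j0 -> (f j <= k)%N.
Proof.
rewrite leqNgt submax_family_gt -ltnNge => card_lt.
have card_le1 : (#|[pred j | (k < f j)%N]| <= 1)%N.
  by rewrite -ltnS (leq_trans card_lt) // geq_minl.
case: (pickP [pred j | (k < f j)%N]) => [j0 j0P|none].
  exists j0 => j; rewrite leqNgt; apply: contraNN => jP.
  by apply/eqP/(card_le1_eqP card_le1).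
(* If no value exceeds [k], any index serves as the exception. *)
by exists (Ordinal m_gt0) => j _; rewrite leqNgt; move: (none j) => /= ->.
Qed.

End SubmaxFamily.

(** * Rank bounds for matrices *)

Section MatrixRank.
Variable F : fieldType.

(** [f] and [g] may repeat indices: two matrices that are row or column selections of each other
    thus have equal rank. *)
Lemma mxrank_mxsub_le (m n m' n' : nat) (f : 'I_m' -> 'I_m) (g : 'I_n' -> 'I_n)
    (A : 'M[F]_(m, n)) : (\rank (mxsub f g A) <= \rank A)%N.
Proof.
rewrite -{1}[A]mulmx1 mxsub_mul (leq_trans (mxrankM_maxl _ _)) //.
exact/mxrankS/rowsub_sub.
Qed.

(** In a rank factorization of inner dimension at most one, each entry is zero or a row factor times
    a column factor. *)
Lemma mxrank_le1_minor (m n : nat) (A : 'M[F]_(m, n)) a b c d :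
  (\rank A <= 1)%N -> A a c * A b d = A b c * A a d.
Proof.
rewrite -[in X in _ -> X](mulmx_base A).
move: (\rank A) (col_base A) (row_base A) => [|[|r]] C D // _.
  by rewrite !mxE !big_ord0 !mul0r.
by rewrite !mxE !big_ord1 mulrACA [C a 0 * _]mulrC -mulrACA.
Qed.

(** The matrix factors through dimension [#|S|]: its rows in [S], put in place by a 0/1 matrix. *)
Lemma mxrank_support_row (m n : nat) (A : 'M[F]_(m, n)) (S : {set 'I_m}) :
  (forall a b, a \notin S -> A a b = 0) -> (\rank A <= #|S|)%N.
Proof.
move=> A0; have -> : A = (\matrix_(a < m, k < #|S|) (a == enum_val k)%:R) *m
    rowsub enum_val A.
  apply/matrixP => a b; rewrite mxE.
  have [aS|aS] := boolP (a \in S); last rewrite A0 //.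
    rewrite (bigD1 (enum_rank_in aS a)) //= !mxE enum_rankK_in // eqxx mul1r.
    rewrite big1 ?addr0 // => k kN; rewrite !mxE.
    case: eqP => [ak|]; last by rewrite mul0r.
    by case/eqP: kN; apply: enum_val_inj; rewrite enum_rankK_in.
  rewrite big1 // => k _; rewrite !mxE; case: eqP aS => [->|_].
    by rewrite enum_valP.
  by rewrite mul0r.
exact: mulmx_max_rank.
Qed.

End MatrixRank.

(** * Changing one component of a multi-index *)

Section MultiIndex.
Variables (m : nat) (n : 'I_m -> nat).
Implicit Types (i : multi_index n) (j : 'I_m).

Definition update_index i j (a : 'I_(n j)) : multi_index n :=
  finfun (dfwith i a).

Lemma update_index_same i j (a : 'I_(n j)) : update_index i a j = a.
Proof. by rewrite ffunE dfwith_in. Qed.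

Lemma update_index_other i j (a : 'I_(n j)) k :
  j != k -> update_index i a k = i k.
Proof. by move=> jk; rewrite ffunE dfwith_out. Qed.

Lemma update_index_id i j : update_index i (i j) = i.
Proof. by apply/ffunP => k; rewrite ffunE; case: dfwithP. Qed.

Lemma update_indexP i i' j (a : 'I_(n j)) :
  i' j = a -> (forall k, j != k -> i' k = i k) -> i' = update_index i a.
Proof.
by move=> i'j i'k; apply/ffunP => k; rewrite ffunE; case: dfwithP.
Qed.

Lemma insert_index_same j (a : 'I_(n j)) (c : other_index n j) :
  insert_index a c j = a.
Proof.
(* Comparing the underlying naturals makes the casts of [insert_index] disappear. *)
apply: ord_inj; rewrite ffunE; case: (unliftP j j) => // l jl.
by case/eqP: (neq_lift j l).
Qed.

Lemma insert_index_lift j (a : 'I_(n j)) (c : other_index n j) l :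
  insert_index a c (lift j l) = c l.
Proof.
apply: ord_inj; rewrite ffunE; case: (unliftP j (lift j l)) => [l' ll'|lj].
  by have l_eq := lift_inj ll'; subst l'.
by case/eqP: (neq_lift j l); rewrite lj.
Qed.

Lemma insert_update_index i j (a : 'I_(n j)) (c : other_index n j) :
  (forall l, c l = i (lift j l)) -> insert_index a c = update_index i a.
Proof.
move=> ci; apply: update_indexP => [|k]; first exact: insert_index_same.
by case: (unliftP j k) => [l -> _|->]; rewrite ?eqxx // insert_index_lift ci.
Qed.

End MultiIndex.

(** * Fiber matrices and the rank-one criterion *)

Section Fibers.
Variables (R : realType) (m : nat) (n : 'I_m -> nat).
Implicit Types (X : tensor R n) (i p : multi_index n) (j : 'I_m).

(* Lists the mode-[j] fibers of [X], each one repeated [n j] times; it has the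
   rank of the unfolding, but its columns are indexed without reference to the
   dependent type of multi-indices deprived of [j]. *)
Definition fiber_mx j X : 'M[R]_(n j, #|{: multi_index n}|) :=
  \matrix_(a, b) X (update_index (enum_val b) a).

(** Each of the two matrices is a column selection of the other. *)
Lemma mxrank_unfolding j X : \rank (unfolding j X) = \rank (fiber_mx j X).
Proof.
(* An empty mode is treated apart, because [extend] needs some value for component [j]. *)
have [nj0|nj_gt0] := posnP (n j).
  have rk0 q (A : 'M[R]_(n j, q)) : \rank A = 0%N.
    by apply/eqP; rewrite -leqn0 -nj0 rank_leq_row.
  by rewrite !rk0.
pose extend (c : other_index n j) := insert_index (Ordinal nj_gt0) c.
pose restrict (i : multi_index n) : other_index n j :=
  finfun (fun l => i (lift j l)).
have unfoldingE : unfolding j X =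
    colsub (fun b => enum_rank (extend (enum_val b))) (fiber_mx j X).
  apply/matrixP => a b; rewrite !mxE enum_rankK; congr (X _).
  by apply: insert_update_index => l; rewrite insert_index_lift.
have fiberE : fiber_mx j X =
    colsub (fun b => enum_rank (restrict (enum_val b))) (unfolding j X).
  apply/matrixP => a b; rewrite !mxE enum_rankK; congr (X _).
  by apply/esym/insert_update_index => l; rewrite ffunE.
apply/eqP; rewrite eqn_leq {1}unfoldingE mxrank_mxsub_le /=.
by rewrite {1}fiberE mxrank_mxsub_le.
Qed.

Lemma submax_rankE X :
  submax_rank X = submax [seq \rank (fiber_mx j X) | j <- enum 'I_m].
Proof. by congr submax; apply: eq_map => j; rewrite mxrank_unfolding. Qed.

Lemma fiber_mx_eq0 j X : (\rank (fiber_mx j X) == 0)%N = (X == 0).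
Proof.
rewrite mxrank_eq0; apply/eqP/eqP => [fib0|->].
  apply/ffunP => i; rewrite -(update_index_id i j) ffunE.
  have /matrixP/(_ (i j) (enum_rank i)) := fib0.
  by rewrite !mxE enum_rankK.
by apply/matrixP => a b; rewrite !mxE ffunE.
Qed.

Lemma fiber_mx_minor j X i i' (a b : 'I_(n j)) : (\rank (fiber_mx j X) <= 1)%N ->
  X (update_index i a) * X (update_index i' b) =
  X (update_index i b) * X (update_index i' a).
Proof.
move=> /(mxrank_le1_minor a b (enum_rank i) (enum_rank i')).
by rewrite !mxE !enum_rankK.
Qed.

(** Rows [e] and columns [c] cut out an identity block of order [k]. *)
Lemma mxrank_fiber_mx_ge k j X (e : 'I_k -> 'I_(n j)) (c : 'I_k -> multi_index n) :
  (forall a b, X (update_index (c b) (e a)) = (a == b)%:R) ->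
  (k <= \rank (fiber_mx j X))%N.
Proof.
move=> Xc; rewrite -{1}(mxrank1 R k).
rewrite -(_ : mxsub e (fun b => enum_rank (c b)) (fiber_mx j X) = 1%:M).
  exact: mxrank_mxsub_le.
by apply/matrixP => a b; rewrite !mxE enum_rankK Xc.
Qed.

Lemma mxrank_fiber_mx_support j X (S : {set 'I_(n j)}) :
  (forall i : multi_index n, i j \notin S -> X i = 0) -> (\rank (fiber_mx j X) <= #|S|)%N.
Proof.
move=> X0; apply: mxrank_support_row => a b aS; rewrite mxE X0 //.
by rewrite update_index_same.
Qed.

(** The fiber matrix is the column [x j] times the row of products of the other factors. *)
Lemma mxrank_fiber_mx_rank_one j X : rank_one X -> (\rank (fiber_mx j X) <= 1)%N.
Proof.
case=> x [_ Xx].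
have -> : fiber_mx j X = (x j)^T *m
    \row_b \prod_(l < m | l != j) x l 0 ((enum_val b : multi_index n) l).
  apply/matrixP => a b; rewrite !mxE big_ord1 !mxE Xx (bigD1 j) //=.
  rewrite update_index_same; congr (_ * _); apply: eq_bigr => l lj.
  by rewrite update_index_other // eq_sym.
exact: mulmx_max_rank.
Qed.

Definition reset_index (s : seq 'I_m) p i : multi_index n :=
  finfun (fun j => if j \in s then p j else i j).

(** By induction on [s]: each newly reset mode costs one minor identity, which contributes one
    quotient. Since [s] is duplicate-free, component [j] is still [i j] when its turn comes. *)
Lemma reset_index_factor X p (s : seq 'I_m) i :
  X p != 0 -> uniq s ->
  (forall j, j \in s -> (\rank (fiber_mx j X) <= 1)%N) ->
  X i = X (reset_index s p i) * \prod_(j <- s) (X (update_index p (i j)) / X p).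
Proof.
move=> Xp0; elim: s => [_ _|j s IHs /= /andP[js s_uniq] rk_le1].
  by rewrite big_nil mulr1; congr (X _); apply/ffunP => j; rewrite ffunE.
rewrite IHs //; last by move=> l ls; rewrite rk_le1 // inE ls orbT.
rewrite big_cons [in RHS]mulrA; congr (_ * _); apply: (mulIf Xp0).
rewrite -mulrA mulfVK //.
have <- : update_index (reset_index s p i) (p j) = reset_index (j :: s) p i.
  apply/esym/update_indexP => [|k jk]; first by rewrite ffunE mem_head.
  by rewrite !ffunE inE eq_sym (negbTE jk).
have {1}<- : update_index (reset_index s p i) (i j) = reset_index s p i.
  by apply/esym/update_indexP => //; rewrite ffunE (negbTE js).
(* Seeing [p] as its own update at [j] turns the goal into a swap of the [j]-th components. *)
rewrite -{2}(update_index_id p j); apply: fiber_mx_minor.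
by rewrite rk_le1 ?mem_head.
Qed.

Lemma rank_oneP X : (0 < m)%N ->
  rank_one X <-> X != 0 /\ exists j0, forall j, j != j0 ->
                                     (\rank (fiber_mx j X) <= 1)%N.
Proof.
move=> m_gt0; split=> [X1|[X0 [j0 rk_le1]]].
  split; last by exists (Ordinal m_gt0) => j _; exact: mxrank_fiber_mx_rank_one.
  have [x [x0 Xx]] := X1; apply/eqP => X0.
  (* A nonzero component of each factor gives a nonzero entry of [X]. *)
  have xj0 j : exists a, x j 0 a != 0 by apply/rV0Pn.
  have := Xx (finfun (fun j => xchoose (xj0 j))); rewrite X0 ffunE => /esym/eqP.
  rewrite prodf_seq_eq0 => /hasP[j _]; rewrite ffunE.
  by rewrite (negbTE (xchooseP (xj0 j))).
have [p Xp0] : exists p, X p != 0.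
  apply/existsP; apply: contraNT X0; rewrite negb_exists => /forallP X0.
  by apply/eqP/ffunP => i; rewrite ffunE; apply/eqP; rewrite -[_ == _]negbK.
(* Every factor is normalized by [X p] except the one in mode [j0], which carries the scale. *)
pose x j : 'rV[R]_(n j) := \row_a
  (X (update_index p a) / (if j == j0 then 1 else X p)).
exists x; split=> [j|i].
  apply/rV0Pn; exists (p j); rewrite mxE update_index_id mulf_neq0 // invr_eq0.
  by case: ifP; rewrite ?oner_eq0.
pose s := [seq j <- index_enum 'I_m | j != j0].
rewrite (@reset_index_factor X p s) ?filter_uniq ?index_enum_uniq //; last first.
  by move=> j; rewrite mem_filter => /andP[/rk_le1].
rewrite big_filter [RHS](bigD1 j0) //= mxE eqxx divr1; congr (X _ * _).
  apply: update_indexP => [|k kj0]; rewrite ffunE mem_filter.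
    by rewrite eqxx.
  by rewrite eq_sym kj0 mem_index_enum.
by apply: eq_bigr => j jj0; rewrite mxE (negbTE jj0).
Qed.

End Fibers.

(** * The rank function axioms and strong properness *)

Section RankFunction.
Variable R : realType.

Lemma submax_rank_eq0 m (n : 'I_m -> nat) (X : tensor R n) :
  (0 < m)%N -> submax_rank X = 0%N <-> X = 0.
Proof.
move=> m_gt0; rewrite submax_rankE; split=> [|X0]; last first.
  rewrite -[RHS](submax_family_const m_gt0); congr submax; apply: eq_map => j.
  by apply/eqP; rewrite fiber_mx_eq0 X0.
apply: contra_eq => X0; rewrite -lt0n -[1%N](submax_family_const m_gt0).
by apply: leq_submax => // j; rewrite lt0n fiber_mx_eq0.
Qed.

Lemma submax_rank_eq1 m (n : 'I_m -> nat) (X : tensor R n) :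
  (0 < m)%N -> submax_rank X = 1%N <-> rank_one X.
Proof.
move=> m_gt0; split=> [rk1|X1].
  apply/rank_oneP => //; split.
    by apply/eqP => /(submax_rank_eq0 X m_gt0); rewrite rk1.
  by apply: submax_le_exists; rewrite // -submax_rankE rk1.
have /(rank_oneP X m_gt0)[X0 _] := X1.
rewrite submax_rankE -[RHS](submax_family_const m_gt0); congr submax.
apply: eq_map => j; apply/eqP.
by rewrite eqn_leq mxrank_fiber_mx_rank_one // lt0n fiber_mx_eq0.
Qed.

(** Every unfolding has full row rank: its columns through the diagonal indices form an identity
    matrix. *)
Lemma submax_rank_identity m n :
  (2 <= m)%N -> submax_rank (identity_tensor R m n) = n.
Proof.
case: m => [|[|m]] // _; rewrite submax_rankE.
rewrite -[RHS](@submax_family_const m.+2) //; congr submax; apply: eq_map => j.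
apply/eqP; rewrite eqn_leq rank_leq_row /=.
apply: (@mxrank_fiber_mx_ge _ _ _ n j _ id (fun b => finfun (fun=> b))) => a b.
rewrite ffunE; congr (_%:R); congr nat_of_bool; apply/idP/eqP => [|->].
  (* A mode other than [j], which exists as the order is at least 2, still holds [b] and forces
     [a = b]. *)
  move=> /forallP/(_ j)/forallP/(_ (lift j ord0))/eqP.
  by rewrite update_index_same update_index_other ?neq_lift // ffunE.
have idx_b k : update_index (finfun (fun=> b) : multi_index (fun=> n)) b k = b.
  by rewrite !ffunE; case: dfwithP => // l; rewrite ffunE.
by apply/forallP => k; apply/forallP => l; rewrite !idx_b.
Qed.

(** Up to repeated columns, the first two unfoldings are [A] and its transpose; this gives the lower
    bound. The other modes have dimension 1. *)
Lemma submax_rank_matrix k n1 n2 (X : tensor R (@matrix_dims k n1 n2))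
    (A : 'M[R]_(n1, n2)) :
  (0 < n1)%N -> (0 < n2)%N -> corresponding_matrix X A ->
  submax_rank X = \rank A.
Proof.
move=> n1_gt0 n2_gt0 XA; rewrite submax_rankE.
set j1 : 'I_k.+2 := lift ord0 ord0.
have dims_gt0 j : (0 < @matrix_dims k n1 n2 j)%N.
  by rewrite /matrix_dims; case: j => [[|[|j]] /= _] //; rewrite nth_nil.
pose i0 : multi_index (@matrix_dims k n1 n2) :=
  finfun (fun j => Ordinal (dims_gt0 j)).
have fiber0E : fiber_mx ord0 X =
    colsub (fun b => (enum_val b : multi_index _) j1) A.
  apply/matrixP => a b; rewrite !mxE XA update_index_same.
  by rewrite update_index_other.
have fiber1E : fiber_mx j1 X =
    colsub (fun b => (enum_val b : multi_index _) ord0) A^T.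
  apply/matrixP => a b; rewrite !mxE XA update_index_same.
  by rewrite update_index_other.
have A0E : A = colsub (fun b => enum_rank (@update_index _ _ i0 j1 b))
                      (fiber_mx ord0 X).
  apply/matrixP => a b; rewrite !mxE XA enum_rankK update_index_same.
  by rewrite update_index_other // update_index_same.
have A1E : A^T = colsub (fun b => enum_rank (@update_index _ _ i0 ord0 b))
                        (fiber_mx j1 X).
  apply/matrixP => a b; rewrite !mxE XA enum_rankK update_index_same.
  by rewrite update_index_other // update_index_same.
apply/eqP; rewrite eqn_leq; apply/andP; split; last first.
  apply: (@submax_ge_pair _ _ _ _ ord0 j1) => //.
    by rewrite {1}A0E mxrank_mxsub_le.
  by rewrite -mxrank_tr {1}A1E mxrank_mxsub_le.
apply: submax_le_family => // j.
(* For nonzero [A], the bound 1 in the trailing modes is at most [\rank A]; for zero [A] all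
   unfoldings vanish. *)
have [A0|] := posnP (\rank A).
  have X0 : X = 0.
    apply/ffunP => i; rewrite XA ffunE.
    by move/eqP: A0; rewrite mxrank_eq0 => /eqP->; rewrite mxE.
  by rewrite A0 leqn0 fiber_mx_eq0 X0.
have [->|j_neq0] := eqVneq j ord0; first by rewrite fiber0E mxrank_mxsub_le.
have [->|j_neq1] := eqVneq j j1.
  by rewrite fiber1E -(mxrank_tr A) mxrank_mxsub_le.
apply: leq_trans; apply: leq_trans (rank_leq_row _) _.
rewrite /matrix_dims; case: j j_neq0 j_neq1 => [[|[|j]] j_lt] //=.
by rewrite nth_nil.
Qed.

Lemma submax_rank_scale m (n : 'I_m -> nat) (X : tensor R n) (a : R) :
  a != 0 -> submax_rank (scale_tensor a X) = submax_rank X.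
Proof.
move=> a0; rewrite !submax_rankE; congr submax; apply: eq_map => j.
rewrite -(mxrank_scale_nz (fiber_mx j X) a0); congr (\rank _).
by apply/matrixP => b c; rewrite !mxE ffunE.
Qed.

(** Mode [j] of [Y] and mode [s j] of [X] have fiber matrices that are column selections of each
    other. *)
Lemma submax_rank_perm m (n : 'I_m -> nat) (s : 'S_m) (X : tensor R n)
    (Y : tensor R (fun j => n (s j))) : (0 < m)%N ->
  mode_permuted X Y -> submax_rank Y = submax_rank X.
Proof.
move=> m_gt0 XY; rewrite !submax_rankE.
rewrite -(submax_perm m_gt0 (fun j => \rank (fiber_mx j X)) s); congr submax.
apply: eq_map => j.
pose permute (i : multi_index n) : multi_index (fun j => n (s j)) :=
  finfun (fun j => i (s j)).
(* The cast is needed because [n (s ((s^-1)%g k))] and [n k] are only provably equal. *)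
pose unpermute (i : multi_index (fun j => n (s j))) : multi_index n :=
  finfun (fun k => cast_ord (congr1 n (permKV s k)) (i ((s^-1)%g k))).
have unpermuteK : cancel unpermute permute.
  move=> i; apply/ffunP => l; rewrite !ffunE; apply: ord_inj => /=.
  by rewrite permK.
have permute_update i (a : 'I_(n (s j))) :
    permute (@update_index _ _ i (s j) a) = @update_index _ _ (permute i) j a.
  apply: update_indexP => [|k jk]; first by rewrite ffunE update_index_same.
  by rewrite !ffunE dfwith_out ?(inj_eq perm_inj).
have fiberE : fiber_mx j Y =
    colsub (fun b => enum_rank (unpermute (enum_val b))) (fiber_mx (s j) X).
  apply/matrixP => a b; rewrite !mxE enum_rankK -XY; congr (Y _).
  by rewrite -[RHS]/(permute _) permute_update unpermuteK.
have fiberE' : fiber_mx (s j) X =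
    colsub (fun b => enum_rank (permute (enum_val b))) (fiber_mx j Y).
  apply/matrixP => a b; rewrite !mxE enum_rankK -XY; congr (Y _).
  by rewrite -[LHS]/(permute _) permute_update.
apply/eqP; rewrite eqn_leq {1}fiberE mxrank_mxsub_le /=.
by rewrite {1}fiberE' mxrank_mxsub_le.
Qed.

(** Each fiber matrix of a subtensor is a submatrix of that of [X], and [submax] is monotone. *)
Lemma submax_rank_subtensor m (n : 'I_m -> nat) (X : tensor R n)
    (T : forall j : 'I_m, {set 'I_(n j)}) : (0 < m)%N ->
  (submax_rank (subtensor X T) <= submax_rank X)%N.
Proof.
move=> m_gt0; rewrite !submax_rankE; apply: leq_submax => // j.
pose widen (i : multi_index (fun j => #|T j|)) : multi_index n :=
  finfun (fun j => enum_val (i j)).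
rewrite (_ : fiber_mx j _ = mxsub (fun a => enum_val a)
    (fun b => enum_rank (widen (enum_val b))) (fiber_mx j X)).
  exact: mxrank_mxsub_le.
apply/matrixP => a b; rewrite !mxE enum_rankK ffunE; congr (X _).
apply: update_indexP => [|k jk]; first by rewrite ffunE update_index_same.
by rewrite !ffunE dfwith_out.
Qed.

Lemma submax_rank_trf : tensor_rank_function (@submax_rank R).
Proof.
split.
- by move=> m n X [m_gt0 _]; apply: submax_rank_eq0.
- by move=> m n X [m_gt0 _]; apply: submax_rank_eq1.
- by move=> m n m_gt1 _; apply: submax_rank_identity.
- exact: submax_rank_matrix.
- by move=> m n X a _; apply: submax_rank_scale.
- by move=> m n s X Y [m_gt0 _]; apply: submax_rank_perm.
- by move=> m n X T [m_gt0 _] _; apply: submax_rank_subtensor.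
Qed.

Lemma submax_rank_strongly_proper : strongly_proper (@submax_rank R).
Proof.
move=> m n X _ [m_gt0 _]; rewrite submax_rankE.
by apply: leq_submax => // j; exact: rank_leq_row.
Qed.

End RankFunction.

(** * Tensors with 0/1 entries and the counterexample to subadditivity *)

Section Indicator.
Variables (R : realType) (m n : nat).
Local Notation index := (multi_index (fun _ : 'I_m => n.+1)).

(** Plain lists of naturals let the conditions on concrete supports be settled by computation. *)
Definition coordinates (i : index) : seq nat :=
  [seq nat_of_ord (i k) | k <- enum 'I_m].

Lemma nth_coordinates (i : index) (k : 'I_m) : nth 0%N (coordinates i) k = i k.
Proof. by rewrite (nth_map k) ?size_enum_ord // nth_ord_enum. Qed.

Definition index_of (l : seq nat) : index := 
  finfun (fun k : 'I_m => inord (nth 0%N l k)).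

(** The two hypotheses keep [nth] and [inord] from falling back on their default values. *)
Lemma coordinates_update (l : seq nat) (j : 'I_m) (a : 'I_n.+1) :
  size l = m -> all (geq n) l ->
  coordinates (@update_index _ _ (index_of l) j a) = set_nth 0%N l j a.
Proof.
move=> size_l l_le; have size_c i : size (coordinates i) = m.
  by rewrite size_map size_enum_ord.
apply: (@eq_from_nth _ 0%N) => [|k].
  by rewrite size_c size_set_nth size_l (maxn_idPr _).
rewrite size_c => k_lt; rewrite -[k]/(val (Ordinal k_lt)) nth_coordinates.
rewrite nth_set_nth /=; have [kj|kj] := eqVneq k j.
  have -> : Ordinal k_lt = j by apply: ord_inj.
  by rewrite update_index_same.
rewrite update_index_other; last by rewrite -val_eqE eq_sym.
by rewrite ffunE inordK // ltnS; apply: (allP l_le); rewrite mem_nth ?size_l.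
Qed.

Definition indicator (S : seq (seq nat)) : tensor R (fun _ : 'I_m => n.+1) :=
  [ffun i : index => (coordinates i \in S)%:R].

Lemma indicator_cat (S T : seq (seq nat)) :
  ~~ has [in S] T -> indicator (S ++ T) = indicator S + indicator T.
Proof.
move=> /hasPn ST; apply/ffunP => i; rewrite !ffunE mem_cat.
have [iT|] := boolP (coordinates i \in T); last by rewrite orbF addr0.
by rewrite (negbTE (ST _ iT)) add0r.
Qed.

Lemma mxrank_indicator_le (S : seq (seq nat)) (j : 'I_m) (A : seq nat) :
  all (fun l => nth 0%N l j \in A) S ->
  (\rank (fiber_mx j (indicator S)) <= size A)%N.
Proof.
move=> /allP SA; pose B := [set k : 'I_n.+1 | nat_of_ord k \in A].
have le_BA : (#|B| <= size A)%N.
  rewrite cardE -(size_map val); apply: uniq_leq_size.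
    by rewrite map_inj_uniq ?enum_uniq //; exact: val_inj.
  by move=> _ /mapP[k kB ->]; rewrite mem_enum inE in kB.
apply: leq_trans le_BA; apply: mxrank_fiber_mx_support => i.
rewrite inE ffunE -nth_coordinates => ijA.
by rewrite (negbTE (contra (SA _) ijA)).
Qed.

(** The lists in [C] name columns of the fiber matrix, on which the last hypothesis displays an
    identity block of order [n.+1]. *)
Lemma mxrank_indicator_full (S C : seq (seq nat)) (j : 'I_m) :
  all (fun l => (size l == m) && all (geq n) l) C -> size C = n.+1 ->
  (forall a b, (a <= n)%N -> (b <= n)%N ->
     (set_nth 0%N (nth [::] C b) j a \in S) = (a == b)) ->
  (n < \rank (fiber_mx j (indicator S)))%N.
Proof.
move=> wfC sizeC SC.
apply: (@mxrank_fiber_mx_ge _ _ _ n.+1 j _ id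
  (fun b => index_of (nth [::] C b))) => a b.
have [size_l l_le] : size (nth [::] C b) = m /\ all (geq n) (nth [::] C b).
  have /(allP wfC)/andP[/eqP] : nth [::] C b \in C by rewrite mem_nth ?sizeC.
  by [].
by rewrite ffunE coordinates_update // SC // -ltnS.
Qed.

End Indicator.

(* The summands have multilinear ranks (3, 2, 2) and (2, 3, 2); their supports
   are separated in every mode, so that the sum has ranks (5, 5, 4). *)
Definition support_322 : seq (seq nat) :=
  [:: [:: 0; 0; 0]; [:: 1; 0; 1]; [:: 2; 1; 0]]%N.
Definition support_232 : seq (seq nat) :=
  [:: [:: 3; 2; 2]; [:: 3; 3; 3]; [:: 4; 4; 2]]%N.

Lemma submax_rank_not_subadditive (R : realType) :
  ~ subadditive (@submax_rank R).
Proof.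
pose X := indicator R 3 4 support_322; pose Y := indicator R 3 4 support_232.
have eq_j (j : 'I_3) : [\/ j = ord0, j = lift ord0 ord0 | j = ord_max].
  by case: j => [[|[|[|j]]] // j_lt];
    [apply: Or31|apply: Or32|apply: Or33]; apply: ord_inj.
have rkX : (submax_rank X <= 2)%N.
  (* The first mode, of rank 3, is the exception; in both other modes the support only uses the
     components 0 and 1. *)
  rewrite submax_rankE; apply: (@submax_le_all_but _ _ _ _ ord0) => // j.
  case: (eq_j j) => -> // _.
    exact: (@mxrank_indicator_le _ _ _ _ _ [:: 0; 1]%N).
  exact: (@mxrank_indicator_le _ _ _ _ _ [:: 0; 1]%N).
have rkY : (submax_rank Y <= 2)%N.
  rewrite submax_rankE.
  apply: (@submax_le_all_but _ _ _ _ (lift ord0 ord0)) => // j.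
  case: (eq_j j) => -> // _.
    exact: (@mxrank_indicator_le _ _ _ _ _ [:: 3; 4]%N).
  exact: (@mxrank_indicator_le _ _ _ _ _ [:: 2; 3]%N).
have rkXY : (4 < submax_rank (X + Y)%R)%N.
  rewrite -indicator_cat // submax_rankE.
  apply: (@submax_ge_pair _ _ _ _ ord0 (lift ord0 ord0)) => //.
    (* These are support points with first components 0 to 4 in order; [[:: 3; 3; 3]] would repeat
       3. *)
    apply: (@mxrank_indicator_full _ _ _ _ [:: [:: 0; 0; 0]; [:: 1; 0; 1];
      [:: 2; 1; 0]; [:: 3; 2; 2]; [:: 4; 4; 2]]%N) => //.
    by move=> [|[|[|[|[|a]]]]] [|[|[|[|[|b]]]]].
  (* Likewise for the second components; here [[:: 1; 0; 1]] is left out. *)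
  apply: (@mxrank_indicator_full _ _ _ _ [:: [:: 0; 0; 0]; [:: 2; 1; 0];
    [:: 3; 2; 2]; [:: 3; 3; 3]; [:: 4; 4; 2]]%N) => //.
  by move=> [|[|[|[|[|a]]]]] [|[|[|[|[|b]]]]].
move=> /(_ 3%N _ X Y (conj isT (fun=> isT))).
by rewrite leqNgt (leq_ltn_trans (leq_add rkX rkY)).
Qed.

Theorem theorem3p4 (R : realType) :
  [/\ tensor_rank_function (@submax_rank R),
      strongly_proper (@submax_rank R) &
      ~ subadditive (@submax_rank R)].
Proof.
split; first exact: submax_rank_trf.
  exact: submax_rank_strongly_proper.
exact: submax_rank_not_subadditive.
Qed.
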